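(* Consider the Bernoulli model with sample space $X=\{0,1\}$, parameter space $\Theta=[0,1]$, and conditional density $q(\theta,x)=\theta^x(1-\theta)^{1-x}$ with respect to counting measure. Let $\alpha\in(0,0.2)$ and $\epsilon\in(0,\alpha)$. Then there exist a family of $1-\alpha$ credible regions $\tau=(\tau_\pi)_{\pi\in\mathcal M(\Theta)}$ and a prior $\pi_0\in\mathcal M(\Theta)$ such that (i) $\pi_0$ is a matching prior for $\tau$ at level $1-\alpha$; and (ii) for all $\pi\in\mathcal M(\Theta)$ and $x\in X$, the support of $\tau_\pi$ at $x$ is contained in the $\epsilon$-fattening of the support of the $1-(\alpha-\epsilon)$ $P^x_\pi$-credible ball, and the support of the $1-\alpha$ $P^x_\pi$-credible ball is contained in the $\epsilon$-fattening of the support of $\tau_\pi$ at $x$.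
   Context: **Model and posterior.** $\mathcal M(\Theta)$ is the set of Borel probability measures on $\Theta=[0,1]$ (Euclidean metric), $\mathcal B_\Theta$ its Borel $\sigma$-algebra, and $P_\theta$ is the Bernoulli distribution on $\{0,1\}$ with success probability $\theta$. For a prior $\pi\in\mathcal M(\Theta)$, the marginal is $(\pi P)(A)=\int_\Theta P_\theta(A)\,\pi(d\theta)$, and $P^x_\pi$ denotes a fixed version (for all $\pi,x$) of the posterior distribution, satisfying $P^x_\pi(B)=\int_B q(\theta,x)\pi(d\theta)/\int_\Theta q(\theta,x)\pi(d\theta)$ for $\pi P$-almost all $x$ and all $B\in\mathcal B_\Theta$. **Set estimators.** A randomized set estimator is a map $\tau:X\times[0,1]\to\mathcal B_\Theta$ such that $(\theta,x,u)\mapsto\mathbf 1[\theta\in\tau(x,u)]$ is product measurable; its acceptance probability function is $\psi(\theta,x)=\int_0^1\mathbf 1[\theta\in\tau(x,u)]\,du$. It is a $1-\alpha$ credible region with respect to $\pi$ if $\int_\Theta\psi(\theta,x)\,P^x_\pi(d\theta)=1-\alpha$ for $\pi P$-almost all $x$; it is a $1-\alpha$ confidence set if $\int_X(1-\psi(\theta,x))\,P_\theta(dx)\le\alpha$ for all $\theta\in\Theta$. A family of $1-\alpha$ credible regions $(\tau_\pi)_{\pi\in\mathcal M(\Theta)}$ is one in which each $\tau_\pi$ is a $1-\alpha$ credible region with respect to $\pi$. A prior $\pi_0$ is matching for the family at level $1-\alpha$ if $\tau_{\pi_0}$ is both a $1-\alpha$ credible region with respect to $\pi_0$ and a $1-\alpha$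 confidence set. The support of $\tau$ at $x$ is the closure of $\{\theta\in\Theta:\psi(\theta,x)\ne0\}$. **Credible balls.** For $\mu\in\mathcal M(\Theta)$ with mean $M(\mu)$ and $\alpha\in(0,1)$, let $B(r)=\{\theta\in\Theta:|\theta-M(\mu)|\le r\}$ and $L_{\alpha}(\mu)=\inf\{r>0:\mu(B(r))\ge1-\alpha\}$. The $1-\alpha$ $\mu$-credible ball is $B(L_{\alpha}(\mu))\subseteq\Theta$; its support is the closure of this set. **Fattening.** The $\epsilon$-fattening of a subset $A$ of a metric space $(Y,d)$ is $\{y\in Y:\inf_{a\in A}d(a,y)<\epsilon\}$. *)

(* Defs.v *)
From HB Require Import structures.
From mathcomp Require Import all_boot all_order all_algebra.
From mathcomp Require Import all_classical all_reals all_analysis.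

Set Implicit Arguments.
Unset Strict Implicit.
Unset Printing Implicit Defensive.

Import Order.TTheory GRing.Theory Num.Theory.
Import numFieldNormedType.Exports.

Local Open Scope classical_set_scope.
Local Open Scope ring_scope.

Section parameter_space.
Context (R : realType).

Definition Theta : Type := set_type [set` `[0, 1 : R]].

HB.instance Definition _ := PseudoMetric.on Theta.

Fact zero_in_Theta : (0 : R) \in [set` `[0, 1 : R]].
Proof. by rewrite inE /= in_itv /= lexx ler01. Qed.

(* The base point is only there because measurable types are pointed. *)
HB.instance Definition _ :=
  isPointed.Build Theta (exist _ (0 : R) zero_in_Theta).

(* Borel sets of [0, 1], for the subspace topology inherited from R. *)
HB.instance Definition _ := Measurable.copy Theta
  (g_sigma_algebraType (@open Theta)).

Definition Theta_dist (s t : Theta) : R := `|\val s - \val t|.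

Fact Theta_dist_ge0 s t : 0 <= Theta_dist s t.
Proof. exact: normr_ge0. Qed.

Fact Theta_dist_eq0 s t : Theta_dist s t = 0 -> s = t.
Proof. by move/eqP; rewrite normr_eq0 subr_eq0 => /eqP/val_inj. Qed.

Fact Theta_ballE (s : Theta) e : ball s e = [set t | Theta_dist s t < e].
Proof. by []. Qed.

HB.instance Definition _ := PseudoMetric_isMetric.Build R Theta
  Theta_dist_ge0 Theta_dist_eq0 Theta_ballE.

End parameter_space.

(* The infimum is taken in the extended reals, so that the fattening of the
   empty set is empty. *)
Definition fattening (R : realType) (Y : metricType R) (eps : R) (A : set Y) :
    set Y :=
  [set y | (ereal_inf [set (mdist a y)%:E | a in A] < eps%:E)%E].

Section model.
Context (R : realType).
Implicit Types (t : Theta R) (x : bool) (pi mu : probability (Theta R) R).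

(* The sample space {0,1} is [bool], with [true] for 1. *)
Definition model t : probability bool R := bernoulli_prob (\val t).

Definition density t x : R := \val t ^+ x * (1 - \val t) ^+ (1 - x)%N.

(* [density] is the density with respect to the counting measure. *)
Lemma model_density t (A : set bool) :
  model t A = (\sum_(x \in A) (density t x)%:E)%E.
Proof.
have := set_valP t; rewrite /= in_itv /= => t01.
rewrite /model /= /bernoulli_prob t01; apply: eq_fsbigr => x _.
by rewrite /density; case: x; rewrite /= ?expr1 ?expr0 ?mulr1 ?mul1r.
Qed.

Definition marginal pi (A : set bool) : \bar R := (\int[pi]_t model t A)%E.

Definition is_posterior
    (post : probability (Theta R) R -> bool -> probability (Theta R) R) : Prop :=
  forall pi, {ae marginal pi, forall x, forall B : set (Theta R), measurable B ->
    post pi x B =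
    (\int[pi]_(t in B) (density t x)%:E / \int[pi]_t (density t x)%:E)%E}.

(* The randomization variable ranges over [0, 1]; the value of the map at
   other real numbers is junk and is ignored everywhere. *)
Record set_estimator := SetEstimator {
  region :> bool -> R -> set (Theta R) ;
  region_measurable : forall x (u : R), u \in `[0, 1] -> measurable (region x u) ;
  region_jointly_measurable :
    measurable_fun ([set: Theta R * bool] `*` ([set` `[0, 1]] : set R))
      (fun z : Theta R * bool * R => \1_(region z.1.2 z.2) z.1.1 : R) }.

Implicit Types (tau : set_estimator).

Definition acceptance tau t x : \bar R :=
  (\int[lebesgue_measure]_(u in [set` `[0%R, 1%R]]) (\1_(tau x u) t)%:E)%E.

Definition acceptance_support tau x : set (Theta R) :=
  closure [set t | acceptance tau t x <> 0%E].

Definition credible_region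
    (post : probability (Theta R) R -> bool -> probability (Theta R) R)
    (alpha : R) pi tau : Prop :=
  {ae marginal pi, forall x,
    (\int[post pi x]_t acceptance tau t x)%E = (1 - alpha)%:E}.

Definition confidence_set (alpha : R) tau : Prop :=
  forall t, (\int[model t]_x (1 - acceptance tau t x) <= alpha%:E)%E.

Definition credible_family
    (post : probability (Theta R) R -> bool -> probability (Theta R) R)
    (alpha : R) (tau : probability (Theta R) R -> set_estimator) : Prop :=
  forall pi, credible_region post alpha pi (tau pi).

Definition matching_prior
    (post : probability (Theta R) R -> bool -> probability (Theta R) R)
    (alpha : R) (tau : probability (Theta R) R -> set_estimator) pi0 : Prop :=
  credible_region post alpha pi0 (tau pi0) /\ confidence_set alpha (tau pi0).

Definition mean mu : R := (\int[mu]_t \val t)%R.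

Definition mean_ball mu (r : R) : set (Theta R) :=
  [set t | `|\val t - mean mu| <= r].

Definition credible_radius (alpha : R) mu : R :=
  inf [set r | 0 < r /\ ((1 - alpha)%:E <= mu (mean_ball mu r))%E].

Definition credible_ball (alpha : R) mu : set (Theta R) :=
  mean_ball mu (credible_radius alpha mu).

End model.

(* Main.v *)
From HB Require Import structures.
Require Import Defs.
From mathcomp Require Import all_boot all_order all_algebra.
From mathcomp Require Import all_classical all_reals all_analysis.
From mathcomp Require Import measurable_realfun ring lra.

Import Order.TTheory GRing.Theory Num.Theory.
Import numFieldNormedType.Exports.

Local Open Scope classical_set_scope.
Local Open Scope ring_scope.

(* Let s = alpha - eps/2, and let pi0 put mass 1/2 on each of s and 1 - s.  The
   density q(theta, x) is 1 - s at one of these atoms and s at the other, and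
   these values are also their posterior weights given x.  Since
   alpha - eps < s <= alpha, the alpha-ball of the posterior may leave out the
   lighter atom while the (alpha - eps)-ball must contain it; as s < 1/4, this
   places the set {theta | s <= q(theta, x)} between the two balls.  Accepting
   theta with probability 0, 1 - alpha or 1 according to whether
   q(theta, x) < s, s <= q(theta, x) <= 1 - s or 1 - s < q(theta, x) gives that
   set as support, credibility exactly 1 - alpha, because both atoms are
   accepted with probability 1 - alpha, and coverage at least 1 - alpha, because
   the acceptance probabilities at x = 0 and x = 1 are averaged with weights
   q(theta, 0) and q(theta, 1) = 1 - q(theta, 0).
   For any other prior, accept the points of the alpha-ball B of the posterior
   mu with the constant probability (1 - alpha) / mu(B). *)

(** * Measurability on Theta, and estimators with a prescribed acceptance probability *)

Lemma measurable_Theta_val (R : realType) :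
  measurable_fun [set: Theta R] (fun t => \val t : R).
Proof.
apply: (measurability _ (RGenOpens.measurableE R)) => _ [_ [a [b ->]] <-].
rewrite setTI; apply: sub_sigma_algebra; apply: open_comp.
  by move=> t _; exact: initial_continuous.
exact: interval_open.
Qed.

Lemma measurable_density (R : realType) (x : bool) :
  measurable_fun [set: Theta R] (fun t => density t x).
Proof.
by apply: measurable_funM; apply: measurable_funX => //;
  [|apply: measurable_funB => //]; exact: measurable_Theta_val.
Qed.

Lemma measurable_mean_ball (R : realType) (mu : probability (Theta R) R)
    (r : R) : measurable (mean_ball mu r).
Proof.
rewrite -[mean_ball _ _]setTI.
have mf : measurable_fun [set: Theta R] (fun t => `|\val t - mean mu|).
  apply: measurableT_comp => //; apply: measurable_funB => //.
  exact: measurable_Theta_val.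
have := mf measurableT `]-oo, r]%classic (measurable_itv _).
by congr measurable; apply/seteqP; split=> t /=; rewrite in_itv.
Qed.

(* Take [region x u] to be the set of the [t] with [u < psi x t]. *)
Lemma set_estimator_of_acceptance (R : realType) (psi : bool -> Theta R -> R) :
  (forall x, measurable_fun setT (psi x)) ->
  (forall x t, 0 <= psi x t <= 1) ->
  exists tau : set_estimator R, forall t x, acceptance tau t x = (psi x t)%:E.
Proof.
move=> mpsi psi01.
pose reg x u := [set t | u < psi x t].
have mreg x u : u \in `[(0 : R), 1] -> measurable (reg x u).
  move=> _; rewrite -[reg _ _]setTI.
  have := mpsi x measurableT `]u, +oo[%classic (measurable_itv _).
  by congr measurable; apply/seteqP; split=> t /=; rewrite in_itv /= ?andbT.
have mjreg : measurable_fun ([set: Theta R * bool] `*` ([set` `[0, 1]] : set R))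
    (fun z : Theta R * bool * R => \1_(reg z.1.2 z.2) z.1.1 : R).
  apply: measurable_funTS.
  pose P := [set z : Theta R * bool * R | z.2 < psi z.1.2 z.1.1].
  have mP : measurable P.
    have mf : measurable_fun [set: Theta R * bool * R]
        (fun z => z.2 < psi z.1.2 z.1.1).
      apply: measurable_fun_ltr => //.
      (* The sample space has two points, so joint measurability in parameter and outcome reduces to
         that of the sections [psi true] and [psi false]. *)
      rewrite (_ : (fun z : Theta R * bool * R => psi z.1.2 z.1.1) =
          (fun tb => if tb.2 then psi true tb.1 else psi false tb.1) \o fst).
        by apply: measurableT_comp => //; exact: measurable_fun_if_pair.
      by apply/funext => -[[t []] u].
    by have := mf measurableT [set true] I; rewrite setTI.
  by have : measurable_fun setT (\1_P : _ -> R) by exact: measurable_indic.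
exists (SetEstimator mreg mjreg) => t x.
rewrite /acceptance /=.
transitivity (\int[lebesgue_measure]_(u in [set` `[0%R, 1%R]])
    (\1_(`[0, psi x t[%classic : set R) u)%:E)%E.
  apply: eq_integral => u; rewrite inE /= in_itv /= => /andP[u0 _].
  congr EFin; rewrite !indicE; congr (_%:R); congr nat_of_bool.
  by apply/idP/idP; rewrite !inE /reg /= in_itv /= ?u0.
rewrite integral_indic //= setIidl ?lebesgue_measure_itv /=; last first.
  move=> u /=; rewrite !in_itv /= => /andP[-> u1].
  by have /andP[_ /(lt_le_trans u1)/ltW] := psi01 x t.
have /andP[psi0 _] := psi01 x t.
rewrite lte_fin; case: ltP => [_|le0]; first by rewrite sube0.
by congr EFin; apply/eqP; rewrite eq_le psi0.
Qed.

Lemma subset_fattening (R : realType) (Y : metricType R) (eps : R) (A : set Y) :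
  0 < eps -> A `<=` fattening eps A.
Proof.
move=> eps0 y Ay; rewrite /fattening /=.
apply: (@le_lt_trans _ _ (mdist y y)%:E); last by rewrite mdistxx lte_fin.
by apply: ereal_inf_lbound; exists y.
Qed.

(** * Credible radii and credible balls of an arbitrary law *)

Section credible_ball_theory.
Context (R : realType) (mu : probability (Theta R) R).
Implicit Types a r : R.

Let radii a := [set r : R | 0 < r /\ ((1 - a)%:E <= mu (mean_ball mu r))%E].

Lemma mean_ball_subset r r' : r <= r' -> mean_ball mu r `<=` mean_ball mu r'.
Proof. by move=> rr' t; rewrite /mean_ball /= => /le_trans; apply. Qed.

(** The real [inf] of an empty set is 0 by default, so lower bounds on the radius need a witness.
    The radius 1 + |mean| works by the triangle inequality: its ball is all of Theta. *)
Let radii_nonempty a : 0 <= a -> radii a !=set0.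
Proof.
move=> a0; exists (1 + `|mean mu|); split; first by rewrite ltr_wpDr.
rewrite (_ : mean_ball _ _ = setT) ?probability_setT; last first.
  apply/seteqP; split=> // t _; rewrite /mean_ball /=.
  apply: (le_trans (ler_normB _ _)); rewrite lerD2r.
  have := set_valP t; rewrite /= in_itv /= => /andP[t0 t1].
  by rewrite ger0_norm.
by rewrite lee_fin gerBl.
Qed.

Let radii_lbound a : lbound (radii a) 0.
Proof. by move=> r [/ltW]. Qed.

Lemma credible_radius_le a r : 0 < r -> ((1 - a)%:E <= mu (mean_ball mu r))%E ->
  credible_radius a mu <= r.
Proof. by move=> r0 h; apply: ge_inf => //; exists 0; exact: radii_lbound. Qed.

Lemma credible_radius_ge a r : 0 <= a ->
  (forall r', 0 < r' -> ((1 - a)%:E <= mu (mean_ball mu r'))%E -> r <= r') ->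
  r <= credible_radius a mu.
Proof.
move=> a0 h; apply: lb_le_inf; first exact: radii_nonempty.
by move=> r' [r'0 hr']; exact: h.
Qed.

Lemma credible_ball_subset a a' : 0 <= a' -> a' <= a ->
  credible_ball a mu `<=` credible_ball a' mu.
Proof.
move=> a'0 a'a; apply: mean_ball_subset; apply: credible_radius_ge => // r r0 hr.
apply: credible_radius_le => //; apply: le_trans hr.
by rewrite lee_fin lerD2l lerN2.
Qed.

(** The infimum is attained: the closed ball of radius [L] is the decreasing intersection of the
    balls of radius L + 1/(n+1), each of mass at least 1 - a, and [mu] is continuous from above. *)
Lemma credible_ball_mass a : 0 <= a ->
  ((1 - a)%:E <= mu (credible_ball a mu))%E.
Proof.
move=> a0; set L := credible_radius a mu.
pose F n := mean_ball mu (L + n.+1%:R^-1).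
have -> : credible_ball a mu = \bigcap_n F n.
  apply/seteqP; split=> [t Bt n _|t Ft].
    by apply: (mean_ball_subset _ _ _ _ Bt); rewrite lerDl.
  rewrite /credible_ball /mean_ball /= -/L.
  apply/ler_addgt0Pr => e e0.
  have [n ne] := ltr_add_invr (ltac:(by rewrite ltrDl) : L < L + e).
  by apply: le_trans (ltW ne); exact: Ft.
have mF i : measurable (F i) by exact: measurable_mean_ball.
have cvF : mu \o F @ \oo --> mu (\bigcap_n F n).
  apply: nonincreasing_cvg_mu => //.
  - by rewrite (le_lt_trans (probability_le1 _ _)) ?ltry.
  - exact: bigcap_measurable.
  - move=> m n mn; apply/subsetPset; apply: mean_ball_subset.
    by rewrite lerD2l lef_pV2 ?posrE // ler_nat.
apply: (cvge_ge _ cvF); near=> n; rewrite /=.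
have [r [r0 hr] rL] : exists2 r, radii a r & r < L + n.+1%:R^-1.
  apply: inf_adherent; first by rewrite invr_gt0.
  by split; [exact: radii_nonempty | exists 0; exact: radii_lbound].
apply: (le_trans hr); apply: le_measure; rewrite ?inE //.
  exact: measurable_mean_ball.
exact/mean_ball_subset/ltW.
Unshelve. all: by end_near.
Qed.

End credible_ball_theory.

(** * Two-point distributions *)

Section two_point_distribution.
Context d (T : measurableType d) (R : realType) (point2 : bool -> T).

Let measurable_point2 : measurable_fun [set: bool] point2.
Proof. by []. Qed.

HB.instance Definition _ :=
  isMeasurableFun.Build _ _ _ _ point2 measurable_point2.

(** A pushforward of the Bernoulli law, hence a probability measure by construction; [w] is the
    weight attached to [point2 true]. *)
Definition two_point (w : R) : probability T R :=
  distribution (bernoulli_prob w) point2.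

Lemma integral_two_point (w : R) (D : set T) (f : T -> \bar R) :
  0 <= w <= 1 -> measurable D -> measurable_fun D f ->
  (forall t, 0 <= f t)%E ->
  (\int[two_point w]_(t in D) f t =
   w%:E * (f (point2 true) * (\1_D (point2 true))%:E) +
   (1 - w)%:E * (f (point2 false) * (\1_D (point2 false))%:E))%E.
Proof.
move=> w01 mD mf f0.
rewrite /two_point ge0_integral_pushforward // integral_mkcond.
rewrite integral_bernoulli_prob //; last first.
  by move=> b; rewrite patchE; case: ifP => _; [exact: f0|].
have patch1 b : ((f \o point2) \_ (point2 @^-1` D)) b =
    (f (point2 b) * (\1_D (point2 b))%:E)%E.
  rewrite patchE indicE /= -[b \in _]/(point2 b \in D).
  by case: (_ \in D); rewrite ?mule1 ?mule0.
by rewrite !patch1.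
Qed.

Lemma two_pointE (w : R) (A : set T) : 0 <= w <= 1 -> measurable A ->
  two_point w A = (w * \1_A (point2 true) + (1 - w) * \1_A (point2 false))%:E.
Proof.
move=> w01 mA; rewrite /two_point /= /distribution /pushforward.
by rewrite bernoulli_probE // !diracE !indicE -!EFinM -EFinD.
Qed.

End two_point_distribution.
Arguments two_point {d T R} point2 w.

(** * The posterior of the uniform prior on {s, 1 - s} *)

Lemma densityE (R : realType) (t : Theta R) (x : bool) :
  density t x = if x then \val t else 1 - \val t.
Proof. by rewrite /density; case: x; rewrite /= ?expr1 ?expr0 ?mulr1 ?mul1r. Qed.

Lemma density_ge0_le1 (R : realType) (t : Theta R) x : 0 <= density t x <= 1.
Proof.
have := set_valP t; rewrite /= in_itv /= densityE => /andP[t0 t1].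
by case: x => /=; apply/andP; split; lra.
Qed.

(** Each outcome has positive probability under both atoms, so for this prior a property of almost
    all outcomes holds for every outcome. *)
Lemma marginal_two_point_neq0 (R : realType) (s : R) (atom : bool -> Theta R)
    x (A : set bool) :
  0 < s < 1 -> (forall b, \val (atom b) = if b then 1 - s else s) ->
  A x -> marginal (two_point atom (1 / 2)) A <> 0%E.
Proof.
move=> /andP[s0 s1] val_atom Ax; rewrite /marginal integral_two_point //.
- rewrite !indicT !mule1 => /eqP.
  have model_gt0 b : (0 < model (atom b) A)%E.
    apply: (@lt_le_trans _ _ (model (atom b) [set x])).
      rewrite model_density fsbig_set1 lte_fin densityE val_atom.
      by case: x {Ax} => /=; case: b; lra.
    by apply: le_measure; rewrite ?inE // => _ ->.
  rewrite padde_eq0; [|by rewrite mule_ge0 ?ltW // lte_fin; lra..].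
  by rewrite gt_eqF // mule_gt0 // lte_fin; lra.
- by apply/andP; split; lra.
- exact: (measurableT_comp (measurable_bernoulli_prob2 _) (@measurable_Theta_val R)).
Qed.

Lemma posterior_two_point (R : realType) (s : R) (atom : bool -> Theta R)
    (post : probability (Theta R) R -> bool -> probability (Theta R) R)
    x (B : set (Theta R)) :
  0 < s < 1 -> (forall b, \val (atom b) = if b then 1 - s else s) ->
  is_posterior post -> measurable B ->
  post (two_point atom (1 / 2)) x B =
  two_point atom (if x then 1 - s else s) B.
Proof.
move=> s01 val_atom /(_ (two_point atom (1 / 2))) [A [_ A0 sub]] mB.
set prior := two_point atom (1 / 2).
(* Were the formula to fail, [x] would lie in the marginal null set [A]. *)
have -> : post prior x B =
    (\int[prior]_(t in B) (density t x)%:E / \int[prior]_t (density t x)%:E)%E.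
  apply: contrapT => neq.
  by apply: (marginal_two_point_neq0 _ s atom x A) => //; apply: sub => /= /(_ _ mB).
have mD D : measurable_fun D (fun t : Theta R => (density t x)%:E).
  by apply: measurable_funTS; apply/measurable_EFinP; exact: measurable_density.
have d0 t : (0 <= (density t x)%:E)%E.
  by rewrite lee_fin; case/andP: (density_ge0_le1 _ t x).
have half01 : 0 <= (1 / 2 : R) <= 1 by apply/andP; split; lra.
case/andP: s01 => s0 s1.
have weight01 : 0 <= (if x then 1 - s else s) <= 1.
  by case: (x) => /=; apply/andP; split; lra.
rewrite !integral_two_point // two_pointE // !indicT !mule1.
rewrite -!EFinM -!EFinD !densityE !val_atom inver.
(* The densities at the two atoms add up to 1, so the normalizing constant 1/2 cancels the prior
   weights and the densities become the posterior weights. *)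
have -> : 1 / 2 * (if x then 1 - s else 1 - (1 - s)) +
    (1 - 1 / 2) * (if x then s else 1 - s) = 1 / 2 :> R by case: (x); lra.
rewrite gt_eqF ?divr_gt0 // -EFinM; congr EFin.
by case: (x); field.
Qed.

(** * Estimators supported on the credible balls, for an arbitrary prior *)

Lemma credible_region_everywhere (R : realType) (alpha : R)
    (post : probability (Theta R) R -> bool -> probability (Theta R) R) pi tau :
  (forall x, \int[post pi x]_t acceptance tau t x = (1 - alpha)%:E)%E ->
  credible_region post alpha pi tau.
Proof.
move=> tauP; exists set0; split=> //; last by move=> x /=.
rewrite /marginal; under eq_integral do rewrite measure0.
by rewrite integral0.
Qed.

Lemma credible_ball_estimator (R : realType) (alpha : R)
    (mu : bool -> probability (Theta R) R) : 0 < alpha < 1 ->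
  exists tau : set_estimator R, forall x,
    (\int[mu x]_t acceptance tau t x)%E = (1 - alpha)%:E /\
    [set t | acceptance tau t x <> 0%E] = credible_ball alpha (mu x).
Proof.
move=> /andP[a0 a1].
pose B x := credible_ball alpha (mu x).
have mB x : measurable (B x) by exact: measurable_mean_ball.
pose p x := fine (mu x (B x)).
have pE x : mu x (B x) = (p x)%:E by rewrite fineK ?fin_num_measure.
have p_ge x : 1 - alpha <= p x.
  by rewrite -lee_fin -pE; apply: credible_ball_mass; exact: ltW.
(* By [p_ge] the constant is at most 1, hence a valid acceptance probability; as it is positive, the
   support is the whole ball. *)
pose c x := (1 - alpha) / p x.
have p_gt0 x : 0 < p x by apply: lt_le_trans (p_ge x); lra.
have c_gt0 x : 0 < c x by rewrite divr_gt0 //; lra.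
have [|x t|tau tauE] := set_estimator_of_acceptance _ (fun x t => c x * \1_(B x) t).
- by move=> x; apply: measurable_funM => //; exact: measurable_indic.
- rewrite indicE; case: (_ \in _); rewrite ?mulr0 ?lexx ?ler01 // mulr1.
  by rewrite ltW //= ler_pdivrMr // mul1r.
exists tau => x; split.
  under eq_integral do rewrite tauE EFinM.
  rewrite ge0_integralZl_EFin //; last 2 first.
  - exact/measurable_EFinP/measurable_indic.
  - exact: ltW.
  have -> : (\int[mu x]_t (\1_(B x) t)%:E = (p x)%:E)%E.
    by rewrite integral_indic // setIT; exact: pE.
  by rewrite -EFinM divfK // gt_eqF.
apply/seteqP; split=> t /=; rewrite tauE indicE.
  by move=> ct; apply: contrapT => nBt; apply: ct; rewrite memNset ?mulr0.
by move=> Bt; rewrite mem_set // mulr1 => -[] /eqP; rewrite gt_eqF.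
Qed.

(** * Credible balls of the two-point posterior *)

(* The posterior given [x] under the uniform prior on {s, 1 - s}. *)
Definition two_point_law (R : realType) (s : R) (x : bool)
    (mu : probability (Theta R) R) : Prop :=
  exists2 atom : bool -> Theta R,
    forall b, \val (atom b) = (if b then 1 - s else s) &
    forall A, measurable A -> mu A = two_point atom (if x then 1 - s else s) A.

(** Read through the density, both posteriors look the same: the atom of density 1 - s has mass 1 -
    s and the other has density and mass s. This removes the case distinction on [x]. *)
Lemma integral_two_point_law (R : realType) (s : R) x mu
    (g : R -> \bar R) (f : Theta R -> \bar R) :
  0 < s < 1 -> two_point_law R s x mu -> measurable_fun setT f ->
  (forall t, 0 <= f t)%E -> (forall t, f t = g (density t x)) ->
  (\int[mu]_t f t = (1 - s)%:E * g (1 - s)%R + s%:E * g s)%E.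
Proof.
move=> /andP[s0 s1] [atom val_atom muE] mf f0 fg.
rewrite (eq_measure_integral (two_point atom (if x then 1 - s else s))).
  rewrite integral_two_point //; last first.
    by case: (x) => /=; apply/andP; split; lra.
  rewrite !indicT !mule1 !fg !densityE !val_atom.
  by case: (x); rewrite ?subKr // addeC.
by move=> A mA _; exact: muE.
Qed.

(** The density is the parameter itself or its reflection at 1/2, which preserves distances and
    carries the mean to m = (1 - s)^2 + s^2 in both cases. *)
Lemma mean_ball_two_point (R : realType) (s : R) x mu r :
  0 < s < 1 -> two_point_law R s x mu ->
  mean_ball mu r = [set t | `|density t x - ((1 - s) ^+ 2 + s ^+ 2)| <= r].
Proof.
move=> s01 lawP.
have dist t : `|\val t - mean mu| =
    `|density t x - (if x then mean mu else 1 - mean mu)|.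
  rewrite densityE; case: (x) => //; rewrite -normrN.
  by congr (`| _ |); ring.
rewrite /mean_ball; under eq_set do rewrite dist.
have s0s1 := s01; case/andP: s0s1 => s0 s1.
rewrite /mean /Rintegral.
rewrite (integral_two_point_law _ s x _ (fun d => (if x then d else 1 - d)%:E)) //.
- rewrite -!EFinM -EFinD /=; congr [set t | `|_ - _| <= _].
  by apply/funext => t; case: (x) => /=; ring.
- by apply/measurable_EFinP; exact: measurable_Theta_val.
- by move=> t; have := set_valP t; rewrite /= in_itv /= => /andP[].
- by move=> t; rewrite densityE; case: (x); rewrite ?subKr.
Qed.

Lemma mean_ball_two_point_mass (R : realType) (s : R) x mu r :
  0 < s < 1 -> two_point_law R s x mu -> mu (mean_ball mu r) =
  ((1 - s) * (`|1 - s - ((1 - s) ^+ 2 + s ^+ 2)| <= r)%R%:R +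
   s * (`|s - ((1 - s) ^+ 2 + s ^+ 2)| <= r)%R%:R)%:E.
Proof.
move=> s01 lawP.
have mB := measurable_mean_ball _ mu r.
rewrite -[mean_ball mu r in LHS]setIT -integral_indic //.
pose g d : \bar R := (`|d - ((1 - s) ^+ 2 + s ^+ 2)| <= r)%R%:R%:E.
rewrite (integral_two_point_law _ s x _ g) ?EFinD ?EFinM //.
  exact/measurable_EFinP/measurable_indic.
move=> t; rewrite indicE (mean_ball_two_point _ s x) // /g.
by congr (_%:R%:E); congr nat_of_bool; apply/idP/idP; rewrite inE.
Qed.

(** Without the atom of mass s a ball has mass at most 1 - s < 1 - a, so the radius is at least the
    distance m - s to that atom, where m = (1 - s)^2 + s^2. *)
Lemma two_point_subset_credible_ball (R : realType) (s : R) x mu a :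
  0 < s < 1 / 4 -> two_point_law R s x mu -> 0 <= a < s ->
  [set t | s <= density t x] `<=` credible_ball a mu.
Proof.
move=> /andP[s0 s1] lawP /andP[a0 sa].
have s01 : 0 < s < 1 by apply/andP; split; lra.
have radius_ge : (1 - s) ^+ 2 + s ^+ 2 - s <= credible_radius a mu.
  apply: credible_radius_ge => // r r0.
  rewrite (mean_ball_two_point_mass _ s x) // lee_fin leNgt => mass.
  rewrite leNgt; apply: contra mass => rlt.
  have -> : (`|s - ((1 - s) ^+ 2 + s ^+ 2)| <= r) = false.
    by apply/negbTE; rewrite -ltNge distrC (lt_le_trans rlt) ?ler_norm.
  by case: (_ <= r); rewrite ?mulr1 ?mulr0; lra.
move=> t /= dt; rewrite /credible_ball (mean_ball_two_point _ s x) //=.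
apply: le_trans radius_ge; have /andP[_ d1] := density_ge0_le1 _ t x.
(* Densities up to 1 stay in reach because (m - s) - (1 - m) = (1 - s)(1 - 4s), which is positive
   for s < 1/4. *)
by rewrite ler_norml; apply/andP; split; nra.
Qed.

(** The heavier atom alone has mass 1 - s >= 1 - a, so the radius is at most its distance 1 - s - m
    = s(1 - 2s) from the mean. *)
Lemma credible_ball_subset_two_point (R : realType) (s : R) x mu a :
  0 < s < 1 / 4 -> two_point_law R s x mu -> s <= a ->
  credible_ball a mu `<=` [set t | s <= density t x].
Proof.
move=> /andP[s0 s1] lawP sa.
have s01 : 0 < s < 1 by apply/andP; split; lra.
have gap_gt0 : 0 < 1 - s - ((1 - s) ^+ 2 + s ^+ 2) by nra.
have radius_le : credible_radius a mu <= 1 - s - ((1 - s) ^+ 2 + s ^+ 2).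
  apply: credible_radius_le => //.
  rewrite (mean_ball_two_point_mass _ s x) // lee_fin (ger0_norm (ltW gap_gt0)) lexx.
  rewrite mulr1; apply: (@le_trans _ _ (1 - s)); first by rewrite lerD2l lerN2.
  by rewrite lerDl mulr_ge0 // ltW.
move=> t; rewrite /credible_ball (mean_ball_two_point _ s x) //=.
move=> /le_trans /(_ radius_le); rewrite ler_norml => /andP[dt _].
(* The lower end of the ball is at density m - (1 - s - m) = s + (1 - 2s)^2. *)
by have := sqr_ge0 (1 - 2 * s); nra.
Qed.

(** * The matching estimator for the two-point prior *)

Lemma two_point_matching_estimator (R : realType) (alpha s : R) :
  alpha < 1 -> 0 < s <= alpha -> s < 1 / 2 ->
  exists tau : set_estimator R,
    [/\ forall x mu, two_point_law R s x mu ->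
          (\int[mu]_t acceptance tau t x)%E = (1 - alpha)%:E,
        confidence_set alpha tau
      & forall x, [set t | acceptance tau t x <> 0%E] =
          [set t | s <= density t x]].
Proof.
move=> alpha1 /andP[s0 sa] s_half.
pose g d : R := if d < s then 0 else if 1 - s < d then 1 else 1 - alpha.
have g01 d : 0 <= g d <= 1.
  by rewrite /g; do 2?case: ifP => _; apply/andP; split; lra.
have mg x : measurable_fun [set: Theta R] (fun t => g (density t x)).
  have md := measurable_density R x.
  by apply: measurable_fun_ifT; [|by []|apply: measurable_fun_ifT => //];
    apply: measurable_fun_ltr.
have [//|x t|tau tauE] :=
    set_estimator_of_acceptance R (fun x t => g (density t x)).
  exact: g01.
exists tau; split.
- move=> x mu lawP.
  have s01 : 0 < s < 1 by apply/andP; split; lra.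
  rewrite (integral_two_point_law _ s x mu (fun d => (g d)%:E)) //.
  (* As s < 1/2, both atoms fall in the middle band, whose ends s and 1 - s are included by the
     strict comparisons in [g]. *)
  + have -> : g (1 - s) = 1 - alpha by rewrite /g; do 2?case: ltP => ?; lra.
    have -> : g s = 1 - alpha by rewrite /g; do 2?case: ltP => ?; lra.
    by rewrite -!EFinM -EFinD; congr EFin; ring.
  + by under eq_fun do rewrite tauE; exact/measurable_EFinP.
  + by move=> t; rewrite tauE lee_fin; case/andP: (g01 (density t x)).
- move=> t; have t01 : 0 <= \val t <= 1.
    by have := set_valP t; rewrite /= in_itv.
  rewrite /model integral_bernoulli_prob //; last first.
    by move=> x; rewrite tauE -EFinB lee_fin subr_ge0; case/andP: (g01 (density t x)).
  rewrite !tauE -!EFinB -!EFinM -EFinD lee_fin !densityE /unstable.onem /g.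
  (* Outside [s, 1 - s] the less likely outcome is rejected and the other accepted, so noncoverage
     is min(t, 1 - t) < s <= alpha; inside, it is exactly alpha. *)
  by case/andP: t01 => t0 t1; do 4?case: ltP => ?; nra.
- move=> x; apply/seteqP; split=> t /=; rewrite tauE /g.
    by case: ltP.
  by rewrite ltNge => -> /=; case: ifP => _ [] /eqP; rewrite ?oner_eq0 //; lra.
Qed.

(** * Choice of the family over all priors *)

Theorem theorem3 (R : realType) (alpha eps : R)
    (post : probability (Theta R) R -> bool -> probability (Theta R) R) :
  0 < alpha < 2 / 10 -> 0 < eps < alpha ->
  is_posterior post ->
  exists (tau : probability (Theta R) R -> set_estimator R)
         (pi0 : probability (Theta R) R),
    [/\ credible_family post alpha tau,
        matching_prior post alpha tau pi0
      & forall (pi : probability (Theta R) R) (x : bool),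
          acceptance_support (tau pi) x `<=`
            fattening eps (closure (credible_ball (alpha - eps) (post pi x))) /\
          closure (credible_ball alpha (post pi x)) `<=`
            fattening eps (acceptance_support (tau pi) x)].
Proof.
move=> /andP[alpha0 alpha1] /andP[eps0 eps1] postP.
pose s := alpha - eps / 2.
have s_lt : s < 1 / 4 by rewrite /s; lra.
have s_alpha : s <= alpha by rewrite /s; lra.
have s_gt : 0 <= alpha - eps < s by rewrite /s; apply/andP; split; lra.
have s0 : 0 < s by rewrite /s; lra.
have atomP b : (if b then 1 - s else s) \in [set` `[0, 1 : R]].
  by rewrite inE /= in_itv /=; case: b; apply/andP; split; lra.
pose atom b : Theta R :=
  exist (fun r : R => r \in [set` `[0, 1 : R]]) _ (atomP b).
pose pi0 : probability (Theta R) R := two_point atom (1 / 2).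
have lawP x : two_point_law R s x (post pi0 x).
  exists atom => // A mA; apply: posterior_two_point => //.
  by apply/andP; split; lra.
(* One specification covers all priors, so that [choice] yields the family; the confidence property
   is asked only at [pi0]. *)
have tauP pi : exists tau : set_estimator R,
    [/\ credible_region post alpha pi tau,
        pi = pi0 -> confidence_set alpha tau
      & forall x, [set t | acceptance tau t x <> 0%E] `<=`
            credible_ball (alpha - eps) (post pi x) /\
          credible_ball alpha (post pi x) `<=`
            [set t | acceptance tau t x <> 0%E]].
  have [->|neq] := pselect (pi = pi0).
    have [| | |tau [cred conf supp]] := two_point_matching_estimator R alpha s.
    - lra.
    - by rewrite s0.
    - lra.
    exists tau; split=> // [|x].
      by apply: credible_region_everywhere => x; exact: cred.
    rewrite supp; split.
      by apply: (two_point_subset_credible_ball _ s) => //; rewrite s0.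
    by apply: (credible_ball_subset_two_point _ s) => //; rewrite s0.
  have [|tau tauP] := credible_ball_estimator R alpha (post pi).
    by apply/andP; split; lra.
  exists tau; split=> // [|x].
    by apply: credible_region_everywhere => x; have [] := tauP x.
  have [_ ->] := tauP x; split=> //.
  by apply: credible_ball_subset; lra.
have [tau tau_spec] := choice tauP; exists tau, pi0; split.
- by move=> pi; have [] := tau_spec pi.
- by have [cred conf _] := tau_spec pi0; split=> //; exact: conf.
- move=> pi x; have [_ _ /(_ x) [inner outer]] := tau_spec pi.
  (* The inclusions hold already for the closures; fattening only enlarges the right-hand sides. *)
  split; apply: (subset_trans _ (subset_fattening _ _ _ _ eps0));
    exact: closure_subset.
Qed.
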